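(* There exist a finite-dimensional commutative local Gorenstein $\mathbb{F}_2$-algebra $R$ and a finitely generated indecomposable non-projective $R$-module $M$ such that $\operatorname{Ext}_R^1(M,M)=0$ and $\operatorname{Ext}_R^2(M,M)=0$.
   Context: $\mathbb{F}_2$ is the field with two elements. A commutative Artinian local ring is Gorenstein if and only if it is self-injective, i.e. injective as a module over itself. *)

(* Defs.v *)
From HB Require Import structures.
From mathcomp Require Import all_boot all_order all_algebra all_field.

Set Implicit Arguments.
Unset Strict Implicit.
Unset Printing Implicit Defensive.

Import GRing.Theory.
Local Open Scope ring_scope.

(* [idealr_closed] already requires ideals to be proper.  Ideals are boolean
   predicates, so this is meant for rings in which membership in an ideal is
   decidable, for instance finite ones; over a commutative ring left ideals are
   two-sided. *)
Definition maximal_ideal (R : nzRingType) (I : {pred R}) : Prop :=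
  idealr_closed I /\
  forall J : {pred R}, idealr_closed J -> {subset I <= J} -> J =i I.

Definition local_ring (R : nzRingType) : Prop :=
  exists I : {pred R}, maximal_ideal I /\
    forall J : {pred R}, maximal_ideal J -> J =i I.

Definition projective (R : nzRingType) (P : lmodType R) : Prop :=
  forall (A B : lmodType R) (p : {linear A -> B}) (f : {linear P -> B}),
    (forall b : B, exists a : A, p a = b) ->
    exists g : {linear P -> A}, forall x : P, p (g x) = f x.

Definition injective_module (R : nzRingType) (E : lmodType R) : Prop :=
  forall (A B : lmodType R) (i : {linear A -> B}) (f : {linear A -> E}),
    injective i ->
    exists g : {linear B -> E}, forall x : A, g (i x) = f x.

(* For a commutative Artinian local ring, being Gorenstein means being
   self-injective; [R^o] is [R] regarded as a module over itself. *)
Definition gorenstein (R : nzRingType) : Prop := injective_module R^o.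

Definition finitely_generated (R : nzRingType) (M : lmodType R) : Prop :=
  exists (n : nat) (e : 'I_n -> M),
    forall x : M, exists c : 'I_n -> R, x = \sum_(i < n) c i *: e i.

Definition zero_module (R : nzRingType) (M : lmodType R) : Prop :=
  forall x : M, x = 0.

(* [(A * B)%type] carries the direct sum module structure. *)
Definition indecomposable (R : nzRingType) (M : lmodType R) : Prop :=
  ~ zero_module M /\
  forall (A B : lmodType R) (f : {linear M -> (A * B)%type}),
    bijective f -> zero_module A \/ zero_module B.

Record projective_resolution (R : nzRingType) (M : lmodType R) := {
  res_mod : nat -> lmodType R;
  res_diff : forall n, {linear res_mod n.+1 -> res_mod n};
  res_aug : {linear res_mod 0%N -> M};
  res_projective : forall n, projective (res_mod n);
  res_aug_surj : forall m : M, exists x, res_aug x = m;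
  res_exact0 : forall x, res_aug x = 0 <-> exists y, res_diff 0 y = x;
  res_exactS : forall n x,
    res_diff n x = 0 <-> exists y, res_diff n.+1 y = x
}.

Section Ext.
Variables (R : nzRingType) (M N : lmodType R) (P : projective_resolution M).

Definition cocycle (n : nat) (f : {linear res_mod P n -> N}) : Prop :=
  forall x, f (res_diff P n x) = 0.

Definition coboundary (n : nat) : {linear res_mod P n -> N} -> Prop :=
  match n with
  | 0 => fun f => forall x, f x = 0
  | m.+1 => fun f => exists g : {linear res_mod P m -> N},
                       forall x, f x = g (res_diff P m x)
  end.

End Ext.

(* Ext^n_R(M, N) = 0: the complex Hom_R(P, N) of a projective resolution P of M
   has zero cohomology in degree n.  By the comparison theorem this does not
   depend on P; asking for some P rather than every P means that the property
   can never hold vacuously. *)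
Definition Ext_vanishes (R : nzRingType) (n : nat) (M N : lmodType R) : Prop :=
  exists P : projective_resolution M,
    forall f : {linear res_mod P n -> N}, cocycle f -> coboundary f.

(* Main.v *)
Require Import Defs.
From HB Require Import structures.
From mathcomp Require Import all_boot all_order all_algebra all_field.
From mathcomp Require Import boolp classical_sets.
Local Open Scope ring_scope.

Set Implicit Arguments.
Unset Strict Implicit.
Unset Printing Implicit Defensive.

Import GRing.Theory.

(** R is the graded Gorenstein algebra with Hilbert function (1, 10, 10, 1)
    attached to a cubic form in ten variables, and M, of Hilbert function
    (4, 37, 16), is the cokernel of a 4 x 3 matrix phi of linear forms.  Its
    minimal resolution starts R^4 <- R^3 <- R^6 with linear maps phi and psi;
    if the columns of chi are fourteen linear syzygies of psi, then the
    vanishing of Ext^1(M, M) and Ext^2(M, M) follows from the exactness of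
    M^4 -> M^3 -> M^6 and M^3 -> M^6 -> M^14.  Each exactness statement over
    F_2 is witnessed by a contracting homotopy, Z Y + X S = 1, computed by
    Gaussian elimination and verified by evaluation.  The same method shows
    that endomorphisms of M act as scalars on M / rad M, so M is
    indecomposable; M is killed by the socle of R, so it is not projective.

    The shape comes from numerical constraints on the Hilbert series: the
    Betti numbers 4, 3, 6 make the graded Euler characteristic of Ext(M, M)
    equal to 1 in degree 0 and leave room for it to vanish in cohomological
    degrees 1 and 2.  The cubic form and phi were found by searching among
    Z/3-equivariant ones and then sparsifying the coordinates.  In
    characteristic 2 the number of variables has to be even, otherwise R has
    an additional first-order deformation of degree -1 that obstructs
    Ext^2(M, M) = 0. *)

(** * Bit sequences as vectors and matrices over F_2 *)

Fixpoint xorv (u v : bitseq) : bitseq :=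
  match u, v with
  | a :: u', b :: v' => (a (+) b) :: xorv u' v'
  | [::], _ => v
  | _, [::] => u
  end.

(** The row vector [u] times the matrix with rows [A]. *)
Fixpoint comb (u : bitseq) (A : seq bitseq) : bitseq :=
  match u, A with
  | b :: u', r :: A' => if b then xorv r (comb u' A') else comb u' A'
  | _, _ => [::]
  end.

(* Rows are compared up to trailing zeros. *)
Definition zerov (u : bitseq) := ~~ has id u.

Definition padv n (u : bitseq) : bitseq := mkseq (nth false u) n.

Definition brow n (u : bitseq) : 'rV['F_2]_n := \row_j (nth false u j)%:R.

Definition bmx m n (A : seq bitseq) : 'M['F_2]_(m, n) :=
  \matrix_(i, j) (nth false (nth [::] A i) j)%:R.

Lemma F2_addb (a b : bool) : (a (+) b)%:R = a%:R + b%:R :> 'F_2.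
Proof. by apply/eqP; case: a; case: b. Qed.

Lemma nth_xorv u v j : nth false (xorv u v) j = nth false u j (+) nth false v j.
Proof.
elim: u v j => [|a u IH] [|b v] [|j] //=; rewrite ?nth_nil ?addbF //.
Qed.

Lemma brow_xor n u v : brow n (xorv u v) = brow n u + brow n v.
Proof. by apply/rowP => j; rewrite !mxE nth_xorv F2_addb. Qed.

Lemma brow_zero n u : zerov u -> brow n u = 0.
Proof.
move=> u0; apply/rowP => j; rewrite !mxE.
case: (ltnP j (size u)) => [ju|ju]; last by rewrite nth_default.
by move/hasPn: u0 => /(_ _ (mem_nth false ju)) /negbTE ->.
Qed.

Lemma brow_pad n u : brow n (padv n u) = brow n u.
Proof. by apply/rowP => j; rewrite !mxE nth_mkseq. Qed.

Lemma row_bmx m n A i : row i (bmx m n A) = brow n (nth [::] A i).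
Proof. by apply/rowP => j; rewrite !mxE. Qed.

Lemma nth_comb m u A j : (size A <= m)%N ->
  (nth false (comb u A) j)%:R =
  \sum_(k < m) (nth false u k)%:R * (nth false (nth [::] A k) j)%:R :> 'F_2.
Proof.
elim: A u m => [|r A IH] u m sA.
  have -> : comb u [::] = [::] by case: u => [|[] u].
  by rewrite nth_nil big1 // => k _; rewrite nth_nil nth_nil mulr0.
case: u => [|b u].
  by rewrite /= nth_nil big1 // => k _; rewrite nth_nil mul0r.
case: m sA => // m sA; rewrite big_ord_recl /= -(IH u m sA).
by case: b; rewrite ?nth_xorv ?F2_addb ?mul1r ?mul0r ?add0r.
Qed.

Lemma brow_comb m n u A : (size A <= m)%N ->
  brow n (comb u A) = brow m u *m bmx m n A.
Proof.
move=> sA; apply/rowP => j; rewrite !mxE (nth_comb _ _ sA).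
by apply: eq_bigr => k _; rewrite !mxE.
Qed.

Lemma brow_eq n u v : zerov (xorv u v) -> brow n u = brow n v.
Proof.
move/(@brow_zero n); rewrite brow_xor => /eqP; rewrite addr_eq0 => /eqP ->.
apply/rowP=> j; rewrite !mxE; apply/eqP; by case: (nth _ _ _).
Qed.

Lemma mem_iota_ord n (k : 'I_n) : (k : nat) \in iota 0 n.
Proof. by rewrite mem_iota /= add0n ltn_ord. Qed.

(** * Algebras and modules given by structure constants *)

Section Rep.
Variables (T : seq (seq bitseq)) (d : nat) (H : seq (seq bitseq)).

Definition opx (x : 'rV['F_2]_22) : 'M['F_2]_d :=
  \sum_(a < 22) x 0 a *: bmx d d (nth [::] H a).

Lemma opx_is_linear : linear opx.
Proof.
move=> k x y; rewrite /opx scaler_sumr -big_split /=; apply: eq_bigr => a _.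
by rewrite !mxE scalerDl scalerA.
Qed.

HB.instance Definition _ :=
  GRing.isLinear.Build 'F_2 'rV['F_2]_22 'M['F_2]_d _ opx opx_is_linear.

Definition opb (f : bitseq) : seq bitseq :=
  mkseq (fun i => padv d (comb f [seq nth [::] h i | h <- H])) d.

Lemma nth_map_nil (i a : nat) :
  nth [::] [seq nth [::] h i | h <- H] a = nth [::] (nth [::] H a) i.
Proof.
case: (ltnP a (size H)) => aH; first by rewrite (nth_map [::]).
by rewrite !nth_default ?size_map //= nth_nil.
Qed.

Lemma row_opx i f : (size H <= 22)%N ->
  row i (opx (brow 22 f)) = brow d (comb f [seq nth [::] h i | h <- H]).
Proof.
move=> sH; rewrite (brow_comb _ _ (m := 22)) ?size_map //.
apply/rowP => j; rewrite !mxE summxE; apply: eq_bigr => a _.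
by rewrite !mxE nth_map_nil.
Qed.

Lemma opx_brow f : (size H <= 22)%N -> opx (brow 22 f) = bmx d d (opb f).
Proof.
move=> sH; apply/row_matrixP => i.
by rewrite row_opx // row_bmx nth_mkseq // brow_pad.
Qed.

(** This is the law (e_a e_b) v = e_a (e_b v) on basis vectors; matrices act on rows from the right,
    whence the order of [b] and [a]. The size bounds keep [comb] in agreement with [bmx]. *)
Definition repb :=
  [&& (size H <= 22)%N, all (fun h => (size h <= d)%N) H &
  all (fun a => all (fun b => all (fun i =>
    zerov (xorv (comb (nth [::] (nth [::] T a) b) [seq nth [::] h i | h <- H])
                (comb (nth [::] (nth [::] H b) i) (nth [::] H a))))
  (iota 0 d)) (iota 0 22)) (iota 0 22)].

End Rep.

Lemma size_nth_le (H : seq (seq bitseq)) d a :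
  all (fun h => size h <= d)%N H -> (size (nth [::] H a) <= d)%N.
Proof.
move=> /allP hH; case: (ltnP a (size H)) => aH; last by rewrite nth_default.
exact/hH/mem_nth.
Qed.

(** By bilinearity the check on basis vectors suffices. With [H = T] this is associativity of R,
    with [H = actM] the module law of M. *)
Lemma opxM T d H x y : repb T d H ->
  opx d H (y *m opx 22 T x) = opx d H y *m opx d H x.
Proof.
case/and3P=> sH sHd /allP hrep.
rewrite [in LHS]mulmx_sum_row linear_sum /= [opx d H y]/opx mulmx_suml.
apply: eq_bigr => b _; rewrite linearZ /= -scalemxAl; congr (_ *: _).
rewrite [opx 22 T x]/opx linear_sum linear_sum /= mulmx_sumr.
apply: eq_bigr => a _; rewrite !linearZ /= -?scalemxAr; congr (_ *: _).
rewrite row_bmx; apply/row_matrixP => i; rewrite row_opx // row_mul row_bmx.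
rewrite -(brow_comb _ _ (size_nth_le _ sHd)); apply: brow_eq.
have ha := hrep _ (mem_iota_ord a).
by apply: (allP (allP ha _ (mem_iota_ord b)) _ (mem_iota_ord i)).
Qed.

(* The monomials of the symmetric trilinear form (a, b, c) -> x_a x_b x_c on the
   degree 1 part, with values in the socle. *)
Definition cubic : seq (seq nat) := [::
  [:: 1; 1; 2]; [:: 1; 1; 4]; [:: 1; 1; 8]; [:: 1; 2; 7]; [:: 1; 3; 8];
  [:: 1; 3; 9]; [:: 1; 4; 4]; [:: 1; 4; 5]; [:: 1; 4; 8]; [:: 1; 5; 8];
  [:: 2; 2; 6]; [:: 2; 2; 9]; [:: 2; 3; 4]; [:: 2; 4; 4]; [:: 2; 4; 5];
  [:: 2; 5; 6]; [:: 2; 6; 10]; [:: 2; 8; 9]; [:: 2; 9; 10]; [:: 3; 3; 3];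
  [:: 3; 4; 6]; [:: 3; 4; 8]; [:: 3; 7; 7]; [:: 3; 10; 10]; [:: 4; 5; 8];
  [:: 4; 7; 8]; [:: 5; 5; 7]; [:: 5; 8; 9]; [:: 6; 6; 6]; [:: 6; 8; 8];
  [:: 6; 8; 10]; [:: 6; 9; 9]; [:: 7; 7; 7]; [:: 7; 7; 10]; [:: 9; 9; 9];
  [:: 10; 10; 10]]%N.

(* The k-th coordinate of e_i e_j in the basis 1 = e_0, e_1, ..., e_10 = x_1,
   ..., x_10, then e_11, ..., e_20 dual to x_10, ..., x_1, and the socle
   e_21; thus e_i e_(21 - i) = e_21 for every i. *)
Definition coef (i j k : nat) : bool :=
  if i == 0%N then k == j else if j == 0%N then k == i else
  if k == 21%N then (i + j == 21)%N
  else has (perm_eq [:: i; j; 21 - k]%N) cubic.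

Definition mulT : seq (seq bitseq) := Eval vm_compute in
  mkseq (fun i => mkseq (fun j => mkseq (coef i j) 22) 22) 22.

Definition symb (T : seq (seq bitseq)) :=
  all (fun a => all (fun b =>
    zerov (xorv (nth [::] (nth [::] T a) b) (nth [::] (nth [::] T b) a)))
  (iota 0 22)) (iota 0 22).

Definition unitb d (H : seq (seq bitseq)) :=
  all (fun i => zerov (xorv (nth [::] (nth [::] H 0) i) (mkseq (pred1 i) d)))
    (iota 0 d).

Lemma mulT_rep : repb mulT 22 mulT. Proof. by vm_compute. Qed.

Lemma mulT_sym : symb mulT. Proof. by vm_compute. Qed.

Lemma mulT_unit : unitb 22 mulT. Proof. by vm_compute. Qed.

Lemma mulT_dual : all (fun i => all (fun j =>
  nth false (nth [::] (nth [::] mulT i) j) 21 == (i + j == 21)%N)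
  (iota 0 22)) (iota 0 22). Proof. by vm_compute. Qed.

Lemma mulT_ideal : all (fun i => all (fun j =>
  nth false (nth [::] (nth [::] mulT i) j) 0 == (i == 0%N) && (j == 0%N))
  (iota 0 22)) (iota 0 22). Proof. by vm_compute. Qed.

Lemma mulT_sq4 : all (fun i =>
    let s := nth [::] (nth [::] mulT i) i in zerov (comb s (opb 22 mulT s)))
  (iota 1 21).
Proof. by vm_compute. Qed.

Arguments mulT : simpl never.
Opaque mulT.

Lemma opx_unit d H : unitb d H -> opx d H (delta_mx 0 0) = 1%:M.
Proof.
move=> /allP hu; rewrite /opx (bigD1 ord0) //= mxE !eqxx scale1r big1 ?addr0.
  apply/row_matrixP => i; rewrite row_bmx (brow_eq _ (hu _ (mem_iota_ord i))).
  apply/rowP => j; rewrite !mxE nth_mkseq //=.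
  by rewrite eq_sym.
by move=> a /negbTE a0; rewrite mxE a0 andbF scale0r.
Qed.

(** * The commutative algebra R *)

Definition gor : Type := 'rV['F_2]_22.
HB.instance Definition _ := GRing.Zmodule.on gor.
HB.instance Definition _ := GRing.Lmodule.on gor.
HB.instance Definition _ := Vector.on gor.
HB.instance Definition _ := Finite.on gor.

Definition gor_mul (x y : gor) : gor := y *m opx 22 mulT x.
Definition gor_one : gor := delta_mx 0 0.

Lemma gmulC : commutative gor_mul.
Proof.
move=> x y; rewrite /gor_mul.
rewrite !mulmx_sum_row /opx.
under eq_bigr do rewrite linear_sum /= scaler_sumr.
under [RHS]eq_bigr do rewrite linear_sum /= scaler_sumr.
rewrite exchange_big /=; apply: eq_bigr => a _; apply: eq_bigr => b _.
rewrite !linearZ /= !scalerA mulrC !row_bmx; congr (_ *: _); apply: brow_eq.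
exact: (allP (allP mulT_sym _ (mem_iota_ord a)) _ (mem_iota_ord b)).
Qed.

Lemma gmulA : associative gor_mul.
Proof.
move=> x y z; rewrite [gor_mul (gor_mul x y) z]/gor_mul [gor_mul x y]/gor_mul.
rewrite (opxM _ _ mulT_rep).
by rewrite /gor_mul mulmxA.
Qed.

Lemma gmul1 : left_id gor_one gor_mul.
Proof. by move=> x; rewrite /gor_mul opx_unit ?mulmx1 ?mulT_unit. Qed.

Lemma gmulDl : left_distributive gor_mul +%R.
Proof. by move=> x y z; rewrite /gor_mul linearD mulmxDr. Qed.

Lemma gone_neq0 : gor_one != 0.
Proof. by apply/eqP => /rowP/(_ 0); rewrite !mxE. Qed.

HB.instance Definition _ :=
  GRing.Zmodule_isComNzRing.Build gor gmulA gmulC gmul1 gmulDl gone_neq0.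

Lemma gscaleAl (k : 'F_2) (x y : gor) : k *: (x * y) = (k *: x) * y.
Proof. by rewrite /GRing.mul /= /gor_mul linearZ /= scalemxAr. Qed.

HB.instance Definition _ := GRing.Lmodule_isLalgebra.Build 'F_2 gor gscaleAl.
HB.instance Definition _ := GRing.Lalgebra_isComAlgebra.Build 'F_2 gor.
HB.instance Definition _ := Algebra_isFalgebra.Build 'F_2 gor.

Lemma gmulE (x y : gor) : x * y = y *m opx 22 mulT x. Proof. by []. Qed.

Lemma F2_cases (k : 'F_2) : k = 0 \/ k = 1.
Proof.
by case: k => [[|[|//]] lk]; [left | right]; apply/val_inj.
Qed.

Definition ge (a : 'I_22) : gor := delta_mx 0 a.

Lemma gor_sum (x : gor) : x = \sum_(a < 22) x 0 a *: ge a.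
Proof. exact: row_sum_delta. Qed.

Definition mulc (a b k : nat) : bool :=
  nth false (nth [::] (nth [::] mulT a) b) k.
Arguments mulc : simpl never.

Lemma gmul_coord (x y : gor) k : (x * y) 0 k =
  \sum_(a < 22) \sum_(b < 22) x 0 a * y 0 b * (mulc a b k)%:R.
Proof.
rewrite mulrC gmulE mulmx_sum_row summxE; apply: eq_bigr => a _.
rewrite mxE /opx linear_sum summxE /= mulr_sumr; apply: eq_bigr => b _.
rewrite linearZ /= row_bmx !mxE mulrA; congr (_ * _).
have := brow_eq 22 (allP (allP mulT_sym _ (mem_iota_ord a)) _ (mem_iota_ord b)).
by move/rowP/(_ k); rewrite !mxE => ->.
Qed.

(** Coordinate 0 is the residue map R -> F_2, whose kernel will be the maximal ideal. *)
Lemma gmul0_coord (x y : gor) : (x * y) 0 0 = x 0 0 * y 0 0.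
Proof.
have c0 (a b : 'I_22) : mulc a b 0 = (a == 0%N :> nat) && (b == 0%N :> nat).
  exact: (eqP (allP (allP mulT_ideal _ (mem_iota_ord a)) _ (mem_iota_ord b))).
rewrite gmul_coord (bigD1 0) // -[LHS]/(_ + _).
rewrite [X in _ + X]big1 ?addr0 => [|a a0].
  rewrite (bigD1 0) // -[LHS]/(_ + _) [X in _ + X]big1 ?addr0 => [|b b0].
    by rewrite (c0 0 0) mulr1.
  by rewrite (c0 0 b) (negbTE (b0 : (b : nat) != 0%N)) mulr0.
rewrite big1 // => b _.
by rewrite (c0 a b) (negbTE (a0 : (a : nat) != 0%N)) mulr0.
Qed.

(** * The socle functional, and R is local *)

Definition soc (x : gor) : 'F_2 := x 0 ord_max.

(** The basis is dual to its own reversal under the pairing soc (x y), by [mulT_dual]. *)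
Lemma socM (x y : gor) : soc (x * y) = \sum_(a < 22) x 0 a * y 0 (rev_ord a).
Proof.
rewrite /soc gmul_coord; apply: eq_bigr => a _.
have c21 (b : 'I_22) : mulc a b 21 = (b == rev_ord a).
  rewrite /mulc.
  rewrite (eqP (allP (allP mulT_dual _ (mem_iota_ord a)) _ (mem_iota_ord b))).
  by rewrite -val_eqE /= subSS -[RHS](eqn_add2l a) subnKC // -ltnS.
rewrite (bigD1 (rev_ord a)) //= [X in _ + X]big1 ?addr0 => [|b ba].
  by rewrite (c21 (rev_ord a)) eqxx mulr1.
by rewrite c21 (negbTE ba) mulr0.
Qed.

Lemma socD x y : soc (x + y) = soc x + soc y.
Proof. by rewrite /soc mxE. Qed.

Lemma soc_ge (x : gor) a : soc (ge a * x) = x 0 (rev_ord a).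
Proof.
rewrite socM (bigD1 a) //= mxE !eqxx mul1r big1 ?addr0 // => b /negbTE ba.
by rewrite mxE ba andbF mul0r.
Qed.

Lemma soc_inj (x y : gor) :
  (forall c : gor, soc (c * x) = soc (c * y)) -> x = y.
Proof.
by move=> h; apply/rowP => a; rewrite -[a]rev_ordK -!soc_ge h.
Qed.

Lemma pchar_gor : 2%N \in [pchar gor].
Proof.
rewrite inE /=; apply/eqP; rewrite -[1]scale1r -scaler_nat.
by rewrite scalerA (_ : 2%:R * 1 = 0 :> 'F_2) ?scale0r //; apply/eqP.
Qed.

(** The fourth power is Frobenius applied twice; thus nilpotence in the maximal ideal can be checked
    on basis vectors. *)
Lemma expr4D (x y : gor) : (x + y) ^+ 4 = x ^+ 4 + y ^+ 4.
Proof.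
have f4 (z : gor) :
    z ^+ 4 = pFrobenius_aut pchar_gor (pFrobenius_aut pchar_gor z).
  by rewrite !pFrobenius_autE -exprM.
by rewrite !f4 !rmorphD.
Qed.

Lemma ge_expr4 (a : 'I_22) : a != 0 -> ge a ^+ 4 = 0.
Proof.
move=> a0; rewrite (exprM _ 2 2) !expr2.
have -> : ge a * ge a = brow 22 (nth [::] (nth [::] mulT a) a).
  rewrite gmulE -rowE /opx (bigD1 a) //= mxE !eqxx scale1r big1 ?addr0.
    by rewrite row_bmx.
  by move=> b /negbTE ba; rewrite mxE ba andbF scale0r.
case/and3P: mulT_rep => sT _ _.
rewrite gmulE opx_brow // -brow_comb ?size_mkseq //.
apply: brow_zero; apply: (allP mulT_sq4 a).
by rewrite mem_iota ltn_ord andbT lt0n.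
Qed.

Lemma gor_nil (x : gor) : x 0 0 = 0 -> x ^+ 4 = 0.
Proof.
move=> x0; rewrite [x]gor_sum.
elim/big_ind: _ => [|u v u4 v4|a _]; first by rewrite expr0n.
  by rewrite expr4D u4 v4 addr0.
rewrite exprZn; have [->|a0] := eqVneq a 0; last by rewrite ge_expr4 ?scaler0.
by rewrite x0 expr0n scale0r.
Qed.

(** Here x = 1 + n with n^4 = 0, so x^4 = 1 + n^4 = 1. *)
Lemma gor_unit (x : gor) : x 0 0 != 0 -> x ^+ 3 * x = 1.
Proof.
have [->|x1 _] := F2_cases (x 0 0); first by rewrite eqxx.
rewrite -exprSr -[x](subrK 1) expr4D expr1n gor_nil ?add0r //.
by rewrite !mxE x1 /= subrr.
Qed.

Lemma gor_local : local_ring gor.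
Proof.
pose I : {pred gor} := [pred x : gor | x 0 0 == 0].
have I_ideal : idealr_closed I.
  split; rewrite ?inE ?mxE //.
  move=> a u v /[!inE] /eqP u0 /eqP v0.
  by rewrite mxE gmul0_coord u0 v0 mulr0 addr0.
(* Elements outside [I] are units, so a proper ideal contains none of them. *)
have sub (J : {pred gor}) : idealr_closed J -> {subset J <= I}.
  case=> J0 J1 JD x Jx; apply: contraNT J1 => /gor_unit <-.
  by rewrite -[_ * _]addr0 JD.
exists I; split=> [|J [Jid Jmax]]; last first.
  by move=> x; rewrite (Jmax I I_ideal (sub J Jid)).
split=> // J Jid IJ x; apply/idP/idP; [exact: sub | exact: IJ].
Qed.

(** * Self-injectivity of R *)

Section ExtendChar2.
Variables (A B : zmodType) (i : {additive A -> B}) (g : {additive A -> 'F_2}).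
Hypothesis (inj_i : injective i) (char2 : forall b : B, b + b = 0).
Local Open Scope classical_set_scope.

(* A maximal subgroup containing i (ker g) and avoiding i a0, where g a0 = 1,
   has index 2. *)
Lemma extend_char2 : exists h : B -> 'F_2,
  (forall x y, h (x + y) = h x + h y) /\ forall a, h (i a) = g a.
Proof.
have [g0|] := pselect (forall a, g a = 0).
  by exists (fun=> 0); split=> [x y|a]; rewrite ?addr0 ?g0.
move=> /existsNP[a0 ga0]; have {}ga0 : g a0 = 1 by case: (F2_cases (g a0)).
(* The last clause demands i (ker g) only of a nonempty [N], so that the union of the empty chain
   qualifies. *)
pose P (N : set B) := [/\ forall x y, N x -> N y -> N (x + y), ~ N (i a0) &
  forall x, N x -> forall a, g a = 0 -> N (i a)].
have addKx (x y : B) : x + (x + y) = y by rewrite addrA char2 add0r.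
have [|N [[ND Na0 NK] Nmax]] := @Zorn_bigcup B P.
  move=> F FP Ftot; split.
  - move=> x y [X FX Xx] [Y FY Yy].
    have [XY|YX] := Ftot _ _ FX FY.
      by exists Y => //; have [+ _ _] := FP _ FY; apply=> //; apply: XY.
    by exists X => //; have [+ _ _] := FP _ FX; apply=> //; apply: YX.
  - by case=> X FX; have [_ + _] := FP _ FX.
  - move=> x [X FX Xx] a ga; exists X => //.
    by have [_ _ /(_ _ Xx _ ga)] := FP _ FX.
have {}NK a : g a = 0 -> N (i a).
  have [[x Nx]|N0] := pselect (exists x, N x); first exact: NK Nx _.
  case: (Nmax [set i a | a in [set a | g a = 0]]).
    split=> [x Nx|sub]; first by case: N0; exists x.
    by apply: N0; exists (i 0); apply: sub; exists 0 => //=; rewrite raddf0.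
  split.
  - move=> _ _ [a1 /= g1 <-] [a2 /= g2 <-].
    exists (a1 + a2); rewrite ?raddfD //=.
    by rewrite g1 g2 addr0.
  - by move=> [a1 /= g1 /inj_i E]; move: ga0; rewrite -E g1 => /eqP.
  - by move=> _ _ a1 g1; exists a1.
have N0 : N 0 by rewrite -(raddf0 i); apply: NK; rewrite raddf0.
(* Otherwise the union of N and N + b would contradict maximality. *)
have Nout b : ~ N b -> N (b + i a0).
  move=> Nb; apply: contrapT => Nb0.
  apply: (Nmax [set x | N x \/ N (x + b)]).
    split=> [x Nx|sub]; first by left.
    by apply: Nb; apply: sub; right; rewrite char2.
  split.
  - move=> x y [Nx|Nx] [Ny|Ny].
    + by left; apply: ND.
    + by right; rewrite -addrA; apply: ND.
    + by right; rewrite addrAC; apply: ND.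
    + by left; have := ND _ _ Nx Ny; rewrite addrACA char2 addr0.
  - by case=> // N1; apply: Nb0; rewrite addrC.
  - by move=> _ _ a /NK; left.
(* The quotient map from B to B / N = F_2. *)
exists (fun b => (~~ `[< N b >])%:R); split=> [x y|a].
  have [Nx|Nx] := asboolP (N x); have [Ny|Ny] := asboolP (N y).
  - by rewrite asboolT ?addr0 //; apply: ND.
  - rewrite asboolF /= ?add0r // => Nxy; apply: Ny.
    by rewrite -(addKx x y); apply: ND.
  - rewrite asboolF /= ?addr0 // => Nxy; apply: Nx.
    by rewrite -(addKx y x) [y + x]addrC; apply: ND.
  - rewrite asboolT /=; first by apply/eqP.
    by have := ND _ _ (Nout _ Nx) (Nout _ Ny); rewrite addrACA char2 addr0.
have [ga|ga] := F2_cases (g a); first by rewrite asboolT ?ga //; apply: NK.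
rewrite asboolF ?ga // => Na; apply: Na0.
rewrite -(addKx (i a) (i a0)); apply: ND => //; rewrite -raddfD; apply: NK.
by rewrite raddfD ga ga0; apply/eqP.
Qed.

End ExtendChar2.

(* soc is a Frobenius form: an additive functional g on B lifts uniquely to
   the R-linear map G with soc (c * G b) = g (c *: b). *)
Lemma gor_gorenstein : gorenstein gor.
Proof.
move=> A B i f inj_i.
have g_add : additive (fun a => soc (f a)).
  by move=> x y /=; rewrite raddfB /soc !mxE.
pose gA := GRing.isAdditive.Build A 'F_2 (fun a => soc (f a)) g_add.
pose g : {additive A -> 'F_2} := HB.pack (fun a => soc (f a)) gA.
have char2 (b : B) : b + b = 0.
  by rewrite -mulr2n -scaler_nat (eqP (andP pchar_gor).2) scale0r.
have [h [hD hi]] := @extend_char2 A B i g inj_i char2.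
have h0 : h 0 = 0 by apply: (@addrI _ (h 0)); rewrite -hD !addr0.
(* The formula is forced: by [soc_ge], coordinate [a] of [G b] is soc (e_(21 - a) * G b). *)
pose G (b : B) : gor := \row_a h (ge (rev_ord a) *: b).
have GE c b : soc (c * G b) = h (c *: b).
  rewrite socM [in RHS](gor_sum c) scaler_suml (big_morph h hD h0).
  apply: eq_bigr => a _; rewrite mxE rev_ordK.
  have [->|->] := F2_cases (c 0 a); first by rewrite mul0r !scale0r h0.
  by rewrite mul1r scale1r.
have G_lin : linear (G : B -> gor^o).
  move=> r x y; apply: soc_inj => c.
  rewrite -[RHS]/(soc (c * (r * G x + G y))) mulrDr socD mulrA !GE -hD.
  by rewrite scalerDr scalerA.
pose GA := GRing.isLinear.Build gor B gor^o _ G G_lin.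
pose GL : {linear B -> gor^o} := HB.pack (G : B -> gor^o) GA.
exists GL => a /=; apply: soc_inj => c; rewrite GE -linearZ hi /=.
by rewrite linearZ.
Qed.

(* Gaussian elimination.  In an echelon form, Some w at position p is the part
   after the pivot p of a row that vanishes before p.  The rows may be longer
   than the echelon form; the excess records a linear combination.  Nothing is
   proved about [ech], [nf] and [solve]: their results are only used through
   the check [factb]. *)
Fixpoint ins (es : seq (option bitseq)) (v : bitseq) : seq (option bitseq) :=
  match es, v with
  | e :: es', b :: v' =>
      if b then
        match e with
        | Some w => e :: ins es' (xorv v' w)
        | None => Some v' :: es'
        end
      else e :: ins es' v'
  | _, _ => es
  end.

Fixpoint nf (es : seq (option bitseq)) (v : bitseq) : bitseq :=
  match es, v with
  | Some w :: es', b :: v' => nf es' (if b then xorv v' w else v')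
  | None :: es', b :: v' => b :: nf es' v'
  | _, _ => v
  end.

Definition ech n (rs : seq bitseq) := foldl ins (nseq n None) rs.

Definition nonpivots (es : seq (option bitseq)) :=
  [seq p <- iota 0 (size es) | nth None es p == None].

Definition unitv n i : bitseq := mkseq (pred1 i) n.

Definition idm n : seq bitseq := mkseq (unitv n) n.

(* A matrix S with n rows such that X S = U, if there is one. *)
Definition solve n (X U : seq bitseq) : seq bitseq :=
  let es := ech n [seq x.1 ++ x.2 | x <- zip X U] in
  let m := size (nth [::] U 0) in
  let c := size (nonpivots es) in
  mkseq (fun j => if nth None es j is None then nseq m false
                  else drop c (nf es (unitv n j ++ nseq m false))) n.

(** * Block matrices and certificates of exactness *)

Definition blocks := nat -> nat -> seq bitseq.

(** Tabulation, so that evaluation computes each block only once. *)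
Definition memo p q (Y : blocks) : blocks :=
  let t := mkseq (fun i => mkseq (Y i) q) p in
  fun i j => nth [::] (nth [::] t i) j.

Definition flat d p q (Y : blocks) : seq bitseq :=
  [seq flatten (mkseq (fun j => nth [::] (Y i j) t) q)
  | i <- iota 0 p, t <- iota 0 d].

Definition slice d1 d2 (A : seq bitseq) : blocks :=
  fun i j => mkseq (fun t =>
    take d2 (drop (j * d2) (nth [::] A (i * d1 + t)))) d1.

Definition sumb (f : nat -> bitseq) n : bitseq :=
  foldr (fun i acc => xorv (f i) acc) [::] (iota 0 n).

(* D = Z Y + X S as block matrices, so that x D = (x Z) Y as soon as x X = 0. *)
Definition factb d1 d2 d3 p q r s (D Y Z X S : blocks) : bool :=
  [&& all (fun j' => all (fun i => (size (Y i j') <= d1)%N) (iota 0 p))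
        (iota 0 s),
      all (fun j' => all (fun k => (size (S k j') <= d3)%N) (iota 0 r))
        (iota 0 s) &
  all (fun j => all (fun j' => all (fun t =>
    zerov (xorv (nth [::] (D j j') t)
      (xorv (sumb (fun i => comb (nth [::] (Z j i) t) (Y i j')) p)
            (sumb (fun k => comb (nth [::] (X j k) t) (S k j')) r))))
   (iota 0 d2)) (iota 0 s)) (iota 0 q)].

(* Exactness of the complex given by Y and X, whose terms are the p-th, q-th
   and r-th powers of spaces of dimensions d1, d2, d3. *)
Definition exactb d1 d2 d3 p q r (Y X : blocks) : bool :=
  let Y := memo p q Y in
  let X := memo q r X in
  let fY := flat d1 p q Y in
  let Z := if p == 0 then [::] else solve (d2 * q) fY (idm (d1 * p)) in
  let U := [seq xorv x.1 (comb x.2 fY) | x <- zip (idm (d2 * q)) Z] in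
  let S := solve (d3 * r) (flat d2 q r X) U in
  factb d1 d2 d3 p q r q (fun j j' => if j == j' then idm d2 else [::])
    Y (memo q p (slice d2 d1 Z)) X (memo r q (slice d3 d2 S)).

(* x D = 0 whenever x X = 0. *)
Definition killb d2 d3 d4 q r s (D X : blocks) : bool :=
  let X := memo q r X in
  let S := solve (d3 * r) (flat d2 q r X) (flat d2 q s D) in
  factb 0 d2 d3 0 q r s D (fun _ _ => [::]) (fun _ _ => [::])
    X (memo r s (slice d3 d4 S)).

Lemma memoE p q Y i j : (i < p)%N -> (j < q)%N -> memo p q Y i j = Y i j.
Proof. by move=> ip jq; rewrite /memo !nth_mkseq. Qed.

Lemma brow_nil n : brow n [::] = 0.
Proof. exact: brow_zero. Qed.

Lemma bmx_nil m n : bmx m n [::] = 0.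
Proof. by apply/matrixP => i j; rewrite !mxE nth_nil nth_nil. Qed.

Lemma bmx_idm n : bmx n n (idm n) = 1%:M.
Proof.
apply/matrixP => i j; rewrite !mxE nth_mkseq // nth_mkseq //=.
by rewrite eq_sym.
Qed.

Lemma brow_sumb n f m : brow n (sumb f m) = \sum_(i < m) brow n (f i).
Proof.
rewrite -(big_mkord xpredT (fun i => brow n (f i))) /index_iota subn0 /sumb.
elim: (iota 0 m) => [|i s IH]; first by rewrite big_nil brow_nil.
by rewrite big_cons /= brow_xor IH.
Qed.

Lemma factP d1 d2 d3 d4 p q r s (D Y Z X S : blocks) :
    factb d1 d2 d3 p q r s D Y Z X S ->
  forall x : 'I_q -> 'rV['F_2]_d2,
  (forall k : 'I_r, \sum_(j < q) x j *m bmx d2 d3 (X j k) = 0) ->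
  forall j' : 'I_s, \sum_(j < q) x j *m bmx d2 d4 (D j j') =
    \sum_(i < p) (\sum_(j < q) x j *m bmx d2 d1 (Z j i)) *m bmx d1 d4 (Y i j').
Proof.
case/and3P=> /allP sY /allP sS /allP hf x xX j'.
have mem := mem_iota_ord.
have DE (j : 'I_q) : bmx d2 d4 (D j j') =
    \sum_(i < p) bmx d2 d1 (Z j i) *m bmx d1 d4 (Y i j') +
    \sum_(k < r) bmx d2 d3 (X j k) *m bmx d3 d4 (S k j').
  apply/row_matrixP => t; rewrite row_bmx.
  have /(brow_eq d4) -> :=
    allP (allP (hf _ (mem _ j)) _ (mem _ j')) _ (mem _ t).
  rewrite brow_xor !brow_sumb linearD !linear_sum /=; congr (_ + _).
    apply: eq_bigr => i _; rewrite row_mul row_bmx (brow_comb _ _ (m := d1)) //.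
    exact: (allP (sY _ (mem _ j'))).
  apply: eq_bigr => k _; rewrite row_mul row_bmx (brow_comb _ _ (m := d3)) //.
  exact: (allP (sS _ (mem _ j'))).
under eq_bigr do rewrite DE mulmxDr !mulmx_sumr.
rewrite big_split /= [X in _ + X](_ : _ = 0) ?addr0.
  rewrite exchange_big /=; apply: eq_bigr => i _; rewrite mulmx_suml.
  by apply: eq_bigr => j _; rewrite mulmxA.
rewrite exchange_big big1 //= => k _.
under eq_bigr do rewrite mulmxA.
by rewrite -mulmx_suml xX mul0mx.
Qed.

(** With the identity for [D], [factP] gives x = (x Z) Y, so x Z is a preimage of x. *)
Lemma exactP d1 d2 d3 p q r (Y X : blocks) : exactb d1 d2 d3 p q r Y X ->
  forall x : 'I_q -> 'rV['F_2]_d2,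
  (forall k : 'I_r, \sum_(j < q) x j *m bmx d2 d3 (X j k) = 0) ->
  exists y : 'I_p -> 'rV['F_2]_d1,
    forall j : 'I_q, x j = \sum_(i < p) y i *m bmx d1 d2 (Y i j).
Proof.
rewrite /exactb; set Z := memo q p _; set S := memo r q _ => ok x xX.
exists (fun i => \sum_(j < q) x j *m bmx d2 d1 (Z j i)) => j.
have := factP d2 ok (x := x) _ j => E.
transitivity (\sum_(j0 < q) x j0 *m
    bmx d2 d2 (if (j0 : nat) == j then idm d2 else [::])).
  rewrite (bigD1 j) //= eqxx bmx_idm mulmx1 big1 ?addr0 // => j0 /negbTE j0j.
  by rewrite (j0j : (j0 : nat) == j = false) bmx_nil mulmx0.
rewrite E => [|k]; first by apply: eq_bigr => i _; rewrite memoE.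
by rewrite -[RHS](xX k); apply: eq_bigr => j0 _; rewrite memoE.
Qed.

Lemma killP d2 d3 d4 q r s (D X : blocks) : killb d2 d3 d4 q r s D X ->
  forall x : 'I_q -> 'rV['F_2]_d2,
  (forall k : 'I_r, \sum_(j < q) x j *m bmx d2 d3 (X j k) = 0) ->
  forall j : 'I_s, \sum_(i < q) x i *m bmx d2 d4 (D i j) = 0.
Proof.
rewrite /killb; set S := memo r s _ => ok x xX j.
rewrite (factP d4 ok) ?big_ord0 // => k.
by rewrite -[RHS](xX k); apply: eq_bigr => j0 _; rewrite memoE.
Qed.

(** * The presentation of M and the checks by evaluation *)

Definition phi_forms : seq (seq (seq nat)) := [::
  [:: [:: 2; 3; 9]; [:: 6; 7]; [:: 1; 4; 8; 9]];
  [:: [:: 6; 9]; [:: 9]; [::]];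
  [:: [:: 4]; [:: 1]; [::]];
  [:: [:: 4; 6; 7]; [:: 3; 7; 8]; [:: 1; 2; 6; 9]]]%N.

Definition psi_forms : seq (seq (seq nat)) := [::
  [:: [:: 5; 8]; [:: 1; 6; 10]; [:: 2; 5; 6; 7]; [:: 4; 6; 7; 8];
      [:: 1; 2; 4; 10]; [:: 4; 5; 7]];
  [:: [:: 2; 5; 7; 8]; [:: 1; 4; 5; 7; 9]; [:: 7; 8; 9]; [:: 1; 2; 8; 9; 10];
      [:: 4; 7; 8; 10]; [:: 1; 5; 7; 10]];
  [:: [:: 1; 6; 7; 8]; [:: 1; 2; 5; 8]; [:: 1; 3; 4; 8]; [:: 2; 8];
      [:: 1; 4; 7; 9]; [:: 1; 2; 9; 10]]]%N.

Definition chi_forms : seq (seq (seq nat)) := [::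
  [:: [:: 9]; [:: 2]; [:: 3; 4]; [::]; [:: 3; 6; 7]; [:: 7; 8; 9]; [:: 2; 5];
      [:: 2; 8; 9; 10]; [:: 2; 9; 10]; [:: 6; 8]; [:: 3; 6; 8];
      [:: 1; 4; 5; 6; 8; 10]; [:: 4; 7; 9]; [:: 2]];
  [:: [:: 6; 8]; [:: 5; 8; 9]; [:: 3; 9]; [:: 7; 8]; [:: 3; 5]; [:: 4; 7];
      [:: 2; 3; 5; 9; 10]; [:: 4; 6; 7]; [:: 8; 9]; [:: 4; 5; 9];
      [:: 1; 4; 8]; [:: 4]; [:: 2; 7]; [:: 1; 3; 6]];
  [:: [:: 3; 5]; [:: 7]; [:: 2; 6]; [:: 2; 3; 5]; [:: 1; 6]; [::];
      [:: 1; 2; 3]; [:: 1; 8]; [:: 1; 2; 6; 9]; [:: 5; 6; 10]; [:: 1; 3; 4];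
      [:: 1; 4]; [:: 4]; [::]];
  [:: [::]; [:: 4]; [:: 2]; [:: 2; 6]; [::]; [:: 1; 8]; [::]; [::]; [::];
      [:: 9]; [:: 5]; [:: 7]; [:: 9]; [:: 4; 10]];
  [:: [:: 5; 6]; [:: 2; 7]; [::]; [::]; [:: 3]; [:: 5; 10]; [::]; [:: 9];
      [:: 7]; [::]; [::]; [::]; [:: 5; 6]; [:: 1; 2; 5; 6]];
  [:: [::]; [::]; [:: 2; 10]; [:: 2; 10]; [:: 10]; [::]; [::]; [::]; [::];
      [:: 4]; [::]; [::]; [:: 5]; [::]]]%N.

(** A list of indices stands for the sum of the variables with these indices, as e_k = x_k for 1 <=
    k <= 10. *)
Definition entry (P : seq (seq (seq nat))) i j : bitseq :=
  let s := nth [::] (nth [::] P i) j in mkseq (fun k => k \in s) 22.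
Definition phi := entry phi_forms.
Definition psi := entry psi_forms.
Definition chi := entry chi_forms.

(* The e_u-coordinate in the i-th copy of R in R^4 is at position 4u + i, so
   that coordinates are sorted by degree. *)
Definition rel_basis : seq (option bitseq) := Eval vm_compute in
  ech 88 [seq flatten (mkseq (fun u => mkseq (fun i =>
    nth false (comb (phi i j) (nth [::] mulT v)) u) 4) 22)
  | j <- iota 0 3, v <- iota 0 22].
(* M has the non-pivot coordinates of R^4 as basis; augM lists the matrices of
   the four components R -> M of the projection. *)
Definition augM : seq (seq bitseq) := Eval vm_compute in
  mkseq (fun i => mkseq (fun u => nf rel_basis (unitv 88 (u * 4 + i))) 22) 4.
Definition actM : seq (seq bitseq) := Eval vm_compute in
  mkseq (fun a => [seq padv 57 (comb (nth [::] (nth [::] mulT a) (p %/ 4))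
                                     (nth [::] augM (p %% 4)))
                  | p <- nonpivots rel_basis]) 22.
Arguments augM : simpl never.
Arguments actM : simpl never.

Definition opR (P : nat -> nat -> bitseq) : blocks :=
  fun i j => opb 22 mulT (P i j).
Definition opM (P : nat -> nat -> bitseq) : blocks :=
  fun i j => opb 57 actM (P i j).
Definition augB : blocks := fun i _ => nth [::] augM i.

Lemma actM_rep : repb mulT 57 actM. Proof. by vm_compute. Qed.

Lemma actM_unit : unitb 57 actM. Proof. by vm_compute. Qed.

Lemma actM_soc :
  all (fun t => zerov (nth [::] (nth [::] actM 21) t)) (iota 0 57).
Proof. by vm_compute. Qed.

(* The maximal ideal maps vectors that vanish before coordinate n to vectors
   that vanish before coordinate m. *)
Definition filb n m := all (fun a => all (fun t =>
  zerov (take m (nth [::] (nth [::] actM a) t))) (iota n (57 - n))) (iota 1 21).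

Lemma actM_fil1 : filb 0 4. Proof. by vm_compute. Qed.

Lemma actM_fil2 : filb 4 41. Proof. by vm_compute. Qed.

Lemma actM_fil3 : filb 41 57. Proof. by vm_compute. Qed.

Lemma augM_act : all (fun i => all (fun a =>
    zerov (xorv (nth [::] (nth [::] augM i) a)
      (comb (nth [::] (nth [::] augM i) 0) (nth [::] actM a))))
    (iota 0 22)) (iota 0 4).
Proof. by vm_compute. Qed.

Lemma augM_gen : all (fun i =>
  zerov (xorv (nth [::] (nth [::] augM i) 0) (unitv 57 i))) (iota 0 4).
Proof. by vm_compute. Qed.

Lemma augM_rel : all (fun j =>
  zerov (sumb (fun i => comb (phi i j) (nth [::] augM i)) 4)) (iota 0 3).
Proof. by vm_compute. Qed.

Definition complexb p q r (P Q : nat -> nat -> bitseq) :=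
  all (fun i => all (fun k =>
    zerov (sumb (fun j => comb (Q j k) (opR P i j)) q)) (iota 0 r)) (iota 0 p).

Lemma phi_psi_complex : complexb 4 3 6 phi psi.
Proof. by vm_compute. Qed.

Lemma psi_chi_complex : complexb 3 6 14 psi chi.
Proof. by vm_compute. Qed.

(** With [r = 0] the kernel condition is empty, so exactness means that R^4 -> M is surjective. *)
Lemma aug_surj : exactb 22 57 0 4 1 0 augB (fun _ _ => [::]).
Proof. by vm_compute. Qed.

(** The indices are swapped since [phi] maps R^3 to R^4 here, whereas applying Hom(-, M) turns it
    into the map M^4 -> M^3 given by [opM phi]. *)
Lemma exact_phi : exactb 22 22 57 3 4 1 (fun j i => opR phi i j) augB.
Proof. by vm_compute. Qed.

Lemma exact_psi :
  exactb 22 22 22 6 3 4 (fun k j => opR psi j k) (fun j i => opR phi i j).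
Proof. by vm_compute. Qed.

Lemma ext1_exact : exactb 57 57 57 4 3 6 (opM phi) (opM psi).
Proof. by vm_compute. Qed.

Lemma ext2_exact : exactb 57 57 57 3 6 14 (opM psi) (opM chi).
Proof. by vm_compute. Qed.

(* Sends x in M^4 to the 4 x 4 matrix of its degree 0 coordinates x_j,t, with
   x_0,0 subtracted on the diagonal. *)
Definition scalB : blocks := fun i j =>
  mkseq (fun s => mkseq (fun t =>
    ((i == j) && (s == t)) (+) [&& j == t, i == 0 & s == 0]) 4) 57.

Lemma end_scalar : killb 57 57 4 4 3 4 scalB (opM phi).
Proof. by vm_compute. Qed.

Opaque mulT actM augM.

(** * The module M and its generators *)

Definition rigM : Type := 'rV['F_2]_57.
HB.instance Definition _ := GRing.Zmodule.on rigM.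

Definition mact (r : gor) (m : rigM) : rigM := m *m opx 57 actM r.

Lemma mactA r s m : mact r (mact s m) = mact (r * s) m.
Proof.
rewrite -[RHS]/(m *m opx 57 actM (s *m opx 22 mulT r)) (opxM _ _ actM_rep).
by rewrite mulmxA.
Qed.

Lemma mact1 : left_id 1 mact.
Proof. by move=> m; rewrite /mact opx_unit ?mulmx1 ?actM_unit. Qed.

Lemma mactDr : right_distributive mact +%R.
Proof. by move=> r u v; rewrite /mact mulmxDl. Qed.

Lemma mactDl m : {morph mact^~ m : r s / r + s}.
Proof. by move=> r s; rewrite /mact linearD mulmxDr. Qed.

HB.instance Definition _ :=
  GRing.Zmodule_isLmodule.Build gor rigM mactA mact1 mactDr mactDl.

Lemma mactE (r : gor) (m : rigM) : r *: m = m *m opx 57 actM r.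
Proof. by []. Qed.

Definition formR (f : bitseq) : gor := brow 22 f.

Lemma formR_mul f (r : gor) : formR f * r = r *m bmx 22 22 (opb 22 mulT f).
Proof. by case/and3P: mulT_rep => s _ _; rewrite gmulE /formR opx_brow. Qed.

Lemma formR_act f (m : rigM) : formR f *: m = m *m bmx 57 57 (opb 57 actM f).
Proof. by case/and3P: actM_rep => s _ _; rewrite mactE /formR opx_brow. Qed.

Definition genM (i : nat) : rigM := brow 57 (nth [::] (nth [::] augM i) 0).

Lemma genM_coord (i : 'I_4) (t : 'I_57) : genM i 0 t = (t == i :> nat)%:R.
Proof.
have /(brow_eq 57)/rowP/(_ t) := allP augM_gen _ (mem_iota_ord i).
by rewrite /genM => ->; rewrite mxE nth_mkseq.
Qed.

(** Row [a] of the tabulated projection is e_a times the image of 1, by [augM_act]. *)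
Lemma genM_act (i : 'I_4) (r : gor) :
  r *: genM i = r *m bmx 22 57 (nth [::] augM i).
Proof.
rewrite mactE [in RHS]mulmx_sum_row /opx linear_sum; apply: eq_bigr => a _.
rewrite /= -scalemxAr row_bmx.
suff -> : brow 57 (nth [::] (nth [::] augM i) a) =
    genM i *m bmx 57 57 (nth [::] actM a) by [].
have := allP (allP augM_act _ (mem_iota_ord i)) _ (mem_iota_ord a).
move/(brow_eq 57) ->; rewrite (brow_comb _ _ (m := 57)) //.
by case/and3P: actM_rep => _ /size_nth_le.
Qed.

Lemma genM_surj (m : rigM) :
  exists x : 'I_4 -> gor, m = \sum_(i < 4) x i *: genM i.
Proof.
have [|x xE] := exactP aug_surj (x := fun _ : 'I_1 => m); first by case.
exists x; rewrite [LHS](xE ord0); apply: eq_bigr => i _.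
by rewrite genM_act.
Qed.

Lemma genM_rel (j : 'I_3) : \sum_(i < 4) formR (phi i j) *: genM i = 0.
Proof.
have /(brow_zero 57) := allP augM_rel _ (mem_iota_ord j).
rewrite brow_sumb => E; rewrite -[RHS]E; apply: eq_bigr => i _.
rewrite genM_act /formR (brow_comb _ _ (m := 22)) //.
have : all (fun i => size (nth [::] augM i) <= 22)%N (iota 0 4) by vm_compute.
by move/allP/(_ _ (mem_iota_ord i)).
Qed.

(** * The radical filtration and the endomorphisms of M *)

Definition lowz n (m : rigM) := forall t : 'I_57, (t < n)%N -> m 0 t = 0.

Lemma lowz_sum n (I : finType) (F : I -> rigM) :
  (forall i, lowz n (F i)) -> lowz n (\sum_i F i).
Proof. by move=> h t tn; rewrite summxE big1 // => i _; apply: h. Qed.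

(** The maximal ideal raises degrees; the relevant bounds are 0, 4, 41 and 57, as M has dimensions
    4, 37, 16 in degrees 0, 1, 2. *)
Lemma lowz_act n n' (r : gor) m :
  filb n n' -> r 0 0 = 0 -> lowz n m -> lowz n' (r *: m).
Proof.
move=> /allP fil r0 mn t tn'; rewrite mactE mxE big1 // => k _.
have [kn|kn] := ltnP k n; first by rewrite mn // mul0r.
rewrite summxE big1 ?mulr0 // => a _; rewrite mxE.
have [->|a0] := eqVneq a 0; first by rewrite r0 mul0r.
have ha : (a : nat) \in iota 1 21.
  rewrite mem_iota lt0n (ltn_ord a) andbT.
  by apply: contra a0 => /eqP a00; apply/eqP/val_inj.
have hk : (k : nat) \in iota n (57 - n).
  by rewrite mem_iota kn subnKC ?ltn_ord // ltnW // (leq_ltn_trans kn).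
have z := allP (fil _ ha) _ hk; rewrite mxE.
suff -> : nth false (nth [::] (nth [::] actM a) k) t = false by rewrite mulr0.
rewrite -(nth_take _ tn'); move: z; move: (take _ _) => u /hasPn z.
case: (ltnP t (size u)) => tu; last by rewrite nth_default.
exact/negbTE/z/mem_nth.
Qed.

Lemma act_split (r : gor) (m : rigM) : exists2 r' : gor, r' 0 0 = 0 &
  r *: m = (r' *: m) + (if r 0 0 == 0 then 0 else m).
Proof.
have [r0|r1] := F2_cases (r 0 0); first by exists r; rewrite ?r0 ?eqxx ?addr0.
exists (r - 1); first by rewrite !mxE r1 subrr.
by rewrite r1 scalerBl scale1r subrK.
Qed.

Lemma lowz_stable n n' (r : gor) m : filb n n' -> (n <= n')%N ->
  lowz n m -> lowz n (r *: m).
Proof.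
move=> fil nn mn t tn; have [r' r0 ->] := act_split r m; rewrite mxE.
rewrite (lowz_act fil r0 mn) ?add0r; last exact: leq_trans tn nn.
by case: ifP; rewrite ?mxE //; rewrite mn.
Qed.

(** Modulo rad M only the residues of the coefficients count, and the generators are the first four
    basis vectors. *)
Lemma genM_coeff (x : 'I_4 -> gor) (i : 'I_4) (t : 'I_57) : t = i :> nat ->
  (\sum_(j < 4) x j *: genM j) 0 t = x i 0 0.
Proof.
move=> ti; rewrite summxE (bigD1 i) //= big1 ?addr0 => [|j ji].
  have [r' r0 ->] := act_split (x i) (genM i); rewrite mxE.
  rewrite (lowz_act actM_fil1 r0) ?add0r ?ti //.
  have [->|->] := F2_cases (x i 0 0); first by rewrite eqxx mxE.
  by rewrite genM_coord ti eqxx.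
have [r' r0 ->] := act_split (x j) (genM j); rewrite mxE.
rewrite (lowz_act actM_fil1 r0) ?add0r ?ti //.
case: ifP => _; first by rewrite mxE.
by rewrite genM_coord ti eq_sym (negbTE (ji : (j : nat) != i)).
Qed.

Lemma lowz4_gen (m : rigM) : lowz 4 m -> exists2 x : 'I_4 -> gor,
  m = \sum_(i < 4) x i *: genM i & forall i, x i 0 0 = 0.
Proof.
move=> m4; have [x xE] := genM_surj m; exists x => // i.
have i57 : (i < 57)%N by apply: leq_trans (ltn_ord i) _.
by rewrite -(genM_coeff x (t := Ordinal i57)) // -xE m4 /=.
Qed.

(* An endomorphism that maps M into rad M maps rad^2 M to 0, so its third power
   vanishes. *)
Lemma idem_rad (e : {linear rigM -> rigM}) : (forall m, e (e m) = e m) ->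
  (forall i : 'I_4, lowz 4 (e (genM i))) -> forall m, e m = 0.
Proof.
move=> ee e4.
have step n n' : filb n n' -> (forall i : 'I_4, lowz n (e (genM i))) ->
    forall m, lowz 4 m -> lowz n' (e m).
  move=> fil en m /lowz4_gen[x -> x0]; rewrite linear_sum; apply: lowz_sum => i.
  by rewrite linearZ; apply: lowz_act fil (x0 i) (en i).
have eM4 m : lowz 4 (e m).
  have [x ->] := genM_surj m; rewrite linear_sum; apply: lowz_sum => i.
  by rewrite linearZ; apply: lowz_stable actM_fil2 _ (e4 i).
have eM41 m : lowz 41 (e m) by rewrite -ee; apply: step actM_fil2 e4 _ (eM4 m).
move=> m; rewrite -ee; apply/rowP => t.
by rewrite (step _ _ actM_fil3 (fun i => eM41 _) _ (eM4 m)) ?mxE.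
Qed.

(** The images of the generators satisfy the relations [phi], so by [end_scalar] they are a scalar
    multiple of the generators modulo rad M; the scalar is 0 or 1. *)
Lemma end_gen (e : {linear rigM -> rigM}) :
  (forall i : 'I_4, lowz 4 (e (genM i))) \/
  (forall i : 'I_4, lowz 4 (genM i - e (genM i))).
Proof.
have kill (j : 'I_4) := killP end_scalar (x := fun i => e (genM i)) _ j.
have {}kill (j : 'I_4) : \sum_(i < 4) e (genM i) *m bmx 57 4 (scalB i j) = 0.
  apply: kill => k.
  have : e (\sum_(i < 4) formR (phi i k) *: genM i) = 0.
    by rewrite genM_rel raddf0.
  rewrite linear_sum => E; rewrite -[RHS]E; apply: eq_bigr => i _.
  by rewrite linearZ /= formR_act.
have i57 (i : 'I_4) : (i < 57)%N by apply: leq_trans (ltn_ord i) _.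
pose c (i t : 'I_4) := (e (genM i) : 'rV_57) 0 (Ordinal (i57 t)).
have cE (j t : 'I_4) : (if j == t then c j t + c 0 0 else c j t) = 0.
  have /rowP/(_ t) := kill j; rewrite summxE mxE => E; rewrite -[RHS]E.
  (* Block (i, j) of [scalB] can be nonzero only for i = j or i = 0. *)
  have colE (i : 'I_4) : ((e (genM i) : 'rV_57) *m bmx 57 4 (scalB i j)) 0 t =
      (if i == j then c i t else 0) +
      (if (j == t) && (i == 0) then c i 0 else 0).
    rewrite mxE; transitivity (\sum_(s < 57) (e (genM i) : 'rV_57) 0 s *
        ((((i == j) && (s == t :> nat))%:R) +
         ([&& j == t, i == 0 & s == 0%N :> nat])%:R)).
      apply: eq_bigr => s _; rewrite mxE nth_mkseq // nth_mkseq // F2_addb.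
      by [].
    under eq_bigr do rewrite mulrDr.
    rewrite big_split /=; congr (_ + _).
      rewrite (bigD1 (Ordinal (i57 t))) //= eqxx andbT.
      rewrite big1 ?addr0; first by case: (i == j); rewrite ?mulr1 ?mulr0.
      move=> s /negbTE st.
      rewrite (_ : (s : nat) == t = false) ?andbF ?mulr0 //.
    rewrite (bigD1 (Ordinal (i57 0))) //= eqxx andbT.
    rewrite big1 ?addr0; first by case: (_ && _); rewrite ?mulr1 ?mulr0.
    move=> s /negbTE st.
    rewrite (_ : (s : nat) == 0%N = false) ?andbF ?mulr0 //.
  under eq_bigr do rewrite colE.
  rewrite big_split /= -big_mkcond big_pred1_eq -big_mkcond /=.
  case: eqP => [->|_]; first by rewrite big_pred1_eq.
  by rewrite big_pred0 ?addr0.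
have c_off (i t : 'I_4) : i != t -> c i t = 0.
  by move=> /negbTE it; have := cE i t; rewrite it.
have c_diag (i : 'I_4) : c i i = c 0 0.
  have := cE i i; rewrite eqxx => /eqP; rewrite addr_eq0 => /eqP ->.
  by case: (F2_cases (c 0 0)) => ->; apply/eqP.
have tE (t : 'I_57) : (t < 4)%N -> exists t', t = Ordinal (i57 t').
  by move=> t4; exists (Ordinal t4); apply/val_inj.
have [c0|c1] := F2_cases (c 0 0); [left | right] => i t /tE[t' ->].
  rewrite -[LHS]/(c i t'); have [->|/c_off //] := eqVneq i t'.
  by rewrite c_diag.
rewrite mxE [X in _ + X]mxE genM_coord -[e _ _ _]/(c i t') /=.
have [->|it] := eqVneq i t'; first by rewrite c_diag c1 eqxx subrr.
by rewrite c_off // eq_sym (negbTE (it : (i : nat) != t')) subrr.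
Qed.

(** * M is finitely generated and indecomposable *)

Lemma rigM_fg : finitely_generated rigM.
Proof.
exists 4, (fun i => genM i) => m; have [x ->] := genM_surj m.
by exists x.
Qed.

Lemma rigM_neq0 : ~ zero_module rigM.
Proof.
move=> z; have /rowP/(_ 0) := z (genM 0); rewrite (genM_coord 0 0) mxE.
by move/eqP; rewrite oner_eq0.
Qed.

(** The projection e onto the summand A is idempotent. By [end_gen], e or 1 - e maps the generators
    into rad M, and that idempotent vanishes by [idem_rad]. *)
Lemma rigM_indecomposable : indecomposable rigM.
Proof.
split=> [|A B f [g fK gK]]; first exact: rigM_neq0.
pose e (m : rigM) : rigM := g ((f m).1, 0).
have e_lin : linear e.
  move=> r u v; apply: (can_inj fK); rewrite linearP !gK linearP /=.
  by congr (_, _); rewrite /= scaler0 addr0.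
pose eA := GRing.isLinear.Build gor rigM rigM _ e e_lin.
pose eL : {linear rigM -> rigM} := HB.pack e eA.
pose e' (m : rigM) : rigM := m - e m.
have e'_lin : linear e'.
  by move=> r u v; rewrite /e' e_lin scalerBr opprD addrACA.
pose eA' := GRing.isLinear.Build gor rigM rigM _ e' e'_lin.
pose eL' : {linear rigM -> rigM} := HB.pack e' eA'.
have ee m : e (e m) = e m by rewrite /e gK.
have [e4|e4] := end_gen eL.
  left=> a; have : e (g (a, 0)) = 0 by apply: (idem_rad (e := eL)).
  rewrite /e gK /= => ga; have := gK (a, 0).
  by rewrite ga linear0 => -[].
right=> b; have : e' (g (0, b)) = 0.
  apply: (idem_rad (e := eL')) => // m /=.
  rewrite /e'; have := raddfB eL m (e m); rewrite /= => ->.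
  by rewrite ee subrr subr0.
rewrite /e' /e gK /= (_ : g (0, 0) = 0) ?subr0 => [gb|]; last first.
  by rewrite -[RHS]fK linear0.
by have := gK (0, b); rewrite gb linear0 => -[].
Qed.

(** * Free modules, and M is not projective *)

Section FreeModules.
Variables (n : nat) (N : lmodType gor) (y : 'I_n -> N).

Definition lsum (x : 'rV[gor]_n) : N := \sum_(i < n) x 0 i *: y i.

Lemma lsum_is_linear : linear lsum.
Proof.
move=> r u v; rewrite /lsum scaler_sumr -big_split /=; apply: eq_bigr => i _.
by rewrite !mxE scalerDl scalerA.
Qed.

HB.instance Definition _ :=
  GRing.isLinear.Build gor 'rV[gor]_n N _ lsum lsum_is_linear.

End FreeModules.

Lemma linear_lsum n (N : lmodType gor) (f : {linear 'rV[gor]_n -> N}) x :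
  f x = lsum (fun i => f (delta_mx 0 i)) x.
Proof.
rewrite [in LHS](row_sum_delta x) linear_sum; apply: eq_bigr => i _.
by rewrite linearZ.
Qed.

Lemma free_projective n : projective 'rV[gor]_n.
Proof.
move=> A B p f p_surj.
pose a i := projT1 (cid (p_surj (f (delta_mx 0 i)))).
have pa i : p (a i) = f (delta_mx 0 i) :=
  projT2 (cid (p_surj (f (delta_mx 0 i)))).
exists (lsum a) => x; rewrite [RHS]linear_lsum linear_sum.
apply: eq_bigr => i _.
by rewrite linearZ /= pa.
Qed.

Definition augL : {linear 'rV[gor]_4 -> rigM} := lsum (fun i : 'I_4 => genM i).

Lemma augL_surj m : exists x, augL x = m.
Proof.
have [x ->] := genM_surj m; exists (\row_i x i); apply: eq_bigr => i _.
by rewrite mxE.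
Qed.

Lemma soc_act (m : rigM) : ge ord_max *: m = 0.
Proof.
rewrite mactE (_ : opx _ _ _ = 0) ?mulmx0 //.
rewrite /opx (bigD1 ord_max) //= mxE !eqxx scale1r big1 ?addr0 => [|a];
  last first.
  by move=> /negbTE am; rewrite mxE am andbF scale0r.
apply/row_matrixP => t; rewrite row_bmx row0; apply: brow_zero.
exact: (allP actM_soc _ (mem_iota_ord t)).
Qed.

(** A section of R^4 -> M would have its values killed by the socle, hence with all coefficients in
    the maximal ideal; then the first generator would lie in rad M. *)
Lemma rigM_nonprojective : ~ projective rigM.
Proof.
move=> /(_ _ _ augL idfun augL_surj)[s sE].
pose m : rigM := genM 0; have := sE m; rewrite /= => mE.
have s0 (i : 'I_4) : (s m) 0 i 0 0 = 0.
  have := linearZ_LR s (ge ord_max) m; rewrite soc_act linear0.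
  move/rowP/(_ i); rewrite !mxE => /(congr1 soc)/esym; rewrite soc_ge.
  rewrite (_ : rev_ord ord_max = 0); last by apply/val_inj; rewrite /= subnn.
  by rewrite /soc mxE.
have E : \sum_(j < 4) (s m) 0 j *: genM j = m := mE.
have := genM_coeff (fun i : 'I_4 => (s m) 0 i) (i := 0) (t := 0) erefl.
rewrite s0 E (genM_coord 0 0) => /eqP.
by rewrite oner_eq0.
Qed.

(** * Matrices of linear forms as maps of free modules *)

Definition formrow (P : nat -> nat -> bitseq) p j : 'rV[gor]_p :=
  \row_(i < p) formR (P i j).

Definition formL (P : nat -> nat -> bitseq) p q :
  {linear 'rV[gor]_q -> 'rV[gor]_p} :=
  lsum (fun j : 'I_q => formrow P p j).

Lemma lsum_formrow (N : lmodType gor) P p j (y : 'I_p -> N) :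
  lsum y (formrow P p j) = \sum_(i < p) formR (P i j) *: y i.
Proof. by apply: eq_bigr => i _; rewrite mxE. Qed.

Lemma formL_coord P p q (x : 'rV[gor]_q) i :
  (formL P p q x) 0 i = \sum_(j < q) x 0 j *m bmx 22 22 (opR P i j).
Proof.
rewrite summxE; apply: eq_bigr => j _.
by rewrite !mxE mulrC formR_mul.
Qed.

Lemma formL_delta P p q (j : 'I_q) : formL P p q (delta_mx 0 j) = formrow P p j.
Proof.
rewrite /formL /= /lsum (bigD1 j) //= mxE !eqxx scale1r big1 ?addr0 // => k.
by move=> /negbTE kj; rewrite mxE kj andbF scale0r.
Qed.

Lemma formL_exact p q r P Q :
  exactb 22 22 22 r q p (fun k j => opR Q j k) (fun j i => opR P i j) ->
  forall x, formL P p q x = 0 -> exists y, formL Q q r y = x.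
Proof.
move=> ok x Px; have [|y yE] := exactP ok (x := fun j => x 0 j).
  by move=> i; rewrite -[LHS](formL_coord P x i) Px mxE.
exists (\row_k y k); apply/rowP => j; rewrite formL_coord yE.
by apply: eq_bigr => k _; rewrite mxE.
Qed.

Lemma aug_exact x : augL x = 0 <-> exists y, formL phi 4 3 y = x.
Proof.
split=> [x0|[y <-]].
  have [|y yE] := exactP exact_phi (x := fun j => x 0 j).
    move=> k; rewrite -[RHS]x0; apply: eq_bigr => i _.
    by rewrite genM_act.
  exists (\row_k y k); apply/rowP => j; rewrite formL_coord yE.
  by apply: eq_bigr => k _; rewrite mxE.
rewrite [formL _ _ _ _]/(lsum _ _) linear_sum big1 // => j _.
by rewrite linearZ [augL _]lsum_formrow genM_rel; apply: scaler0.
Qed.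

Lemma complexP p q r (P Q : nat -> nat -> bitseq) (i : 'I_p) (k : 'I_r) :
  complexb p q r P Q ->
  \sum_(j < q) formR (Q j k) *m bmx 22 22 (opR P i j) = 0.
Proof.
move=> ok; have := allP (allP ok _ (mem_iota_ord i)) _ (mem_iota_ord k).
move/(brow_zero 22); rewrite brow_sumb => E; rewrite -[RHS]E.
by apply: eq_bigr => j _; rewrite (brow_comb _ _ (m := 22)) ?size_mkseq.
Qed.

Lemma formL_formrow p q r (P Q : nat -> nat -> bitseq) (k : 'I_r) :
  complexb p q r P Q -> formL P p q (formrow Q q k) = 0.
Proof.
move=> ok; apply/rowP => i; rewrite formL_coord mxE -[RHS](complexP i k ok).
by apply: eq_bigr => j _; rewrite mxE.
Qed.

Lemma phi_psi x : formL phi 4 3 (formL psi 3 6 x) = 0.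
Proof.
rewrite [formL psi _ _ _]/(lsum _ _) linear_sum big1 // => k _.
by rewrite linearZ (formL_formrow k phi_psi_complex); apply: scaler0.
Qed.

Lemma psi_chi (l : 'I_14) : formL psi 3 6 (formrow chi 6 l) = 0.
Proof. exact: formL_formrow l psi_chi_complex. Qed.

(** * A free resolution of M *)

Definition free_map :=
  {nm : nat * nat & {linear 'rV[gor]_nm.1 -> 'rV[gor]_nm.2}}.

Definition free_map_fun (s : free_map) : {linear _ -> _} := projT2 s.

(** As R is finite, a free module with one basis vector for each element of the source covers the
    kernel; elements outside the kernel are replaced by 0. *)
Definition cover (s : free_map) : free_map :=
  existT (fun nm : nat * nat => {linear 'rV[gor]_nm.1 -> 'rV[gor]_nm.2})
    (#|{: 'rV[gor]_(projT1 s).1}|, (projT1 s).1)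
    (lsum (fun k => if free_map_fun s (enum_val k) == 0
                    then enum_val k else 0)).

Lemma cover_exact s x :
  free_map_fun s x = 0 <-> exists y, free_map_fun (cover s) y = x.
Proof.
split=> [x0|[y <-]].
  exists (delta_mx 0 (enum_rank x)); rewrite /= /lsum (bigD1 (enum_rank x)) //=.
  rewrite mxE !eqxx scale1r enum_rankK x0 eqxx big1 ?addr0 // => k.
  by move=> /negbTE kx; rewrite mxE kx andbF scale0r.
rewrite [free_map_fun (cover s) y]/(lsum _ _) linear_sum big1 // => k _.
rewrite linearZ /=; case: eqP => [->|_]; first by rewrite scaler0.
by rewrite linear0 scaler0.
Qed.

Definition psi_map : free_map :=
  existT (fun nm : nat * nat => {linear 'rV[gor]_nm.1 -> 'rV[gor]_nm.2})
    (6, 3)%N (formL psi 3 6).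

Definition tail n : free_map := iter n cover (cover psi_map).

Definition resolution_mod n : lmodType gor :=
  match n with
  | 0 => 'rV[gor]_4 | 1 => 'rV[gor]_3 | 2 => 'rV[gor]_6
  | k.+3 => 'rV[gor]_(projT1 (tail k)).1
  end.

Definition resolution_diff n :
  {linear resolution_mod n.+1 -> resolution_mod n} :=
  match n with
  | 0 => formL phi 4 3 | 1 => formL psi 3 6 | 2 => free_map_fun (tail 0)
  | k.+3 => free_map_fun (tail k.+1)
  end.

Definition rigM_resolution : projective_resolution rigM.
Proof.
exists resolution_mod resolution_diff augL.
- by case=> [|[|[|n]]]; apply: free_projective.
- exact: augL_surj.
- exact: aug_exact.
- case=> [|[|[|n]]] x.
  + split; first exact: formL_exact exact_psi x.
    by case=> y <-; apply: phi_psi.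
  + exact: (@cover_exact psi_map x).
  + exact: (@cover_exact (tail 0) x).
  + exact: (@cover_exact (tail n.+1) x).
(* Transparent, because the Ext computations unfold the differentials. *)
Defined.

(** * Vanishing of Ext^1(M, M) and Ext^2(M, M) *)

(** The values of [f] on the basis form a vector of M^q in the kernel of [opM Q]; a preimage in M^p
    gives the values of [g]. *)
Lemma extend_hom p q r P Q (f : {linear 'rV[gor]_q -> rigM}) :
  exactb 57 57 57 p q r (opM P) (opM Q) ->
  (forall l : 'I_r, f (formrow Q q l) = 0) ->
  exists g : {linear 'rV[gor]_p -> rigM}, forall x, f x = g (formL P p q x).
Proof.
move=> ok f0; have [|y yE] := exactP ok (x := fun j => f (delta_mx 0 j)).
  move=> l; rewrite -[RHS](f0 l) linear_lsum lsum_formrow.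
  by apply: eq_bigr => j _; rewrite formR_act.
exists (lsum (y : 'I_p -> rigM)) => x.
rewrite linear_lsum [formL _ _ _ _]/(lsum _ _) linear_sum.
apply: eq_bigr => j _.
rewrite linearZ /= lsum_formrow yE; congr (_ *: _).
by apply: eq_bigr => i _; rewrite formR_act.
Qed.

Lemma rigM_Ext1 : Ext_vanishes 1 rigM rigM.
Proof.
exists rigM_resolution => f fc; apply: extend_hom ext1_exact _ => k.
by rewrite -formL_delta; apply: fc.
Qed.

(** A cocycle vanishes on ker psi, the image of the next differential, and so on the columns of
    [chi], which lie there by [psi_chi]. *)
Lemma rigM_Ext2 : Ext_vanishes 2 rigM rigM.
Proof.
exists rigM_resolution => f fc; apply: extend_hom ext2_exact _ => l.
have [+ _] := @cover_exact psi_map (formrow chi 6 l).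
by case=> [|y <-]; [apply: psi_chi | apply: fc].
Qed.

Theorem theorem0p2 :
  exists R : falgType 'F_2,
    (forall x y : R, x * y = y * x) /\
    local_ring R /\
    gorenstein R /\
    exists M : lmodType R,
      finitely_generated M /\
      indecomposable M /\
      ~ projective M /\
      Ext_vanishes 1 M M /\
      Ext_vanishes 2 M M.
Proof.
exists gor; split; first exact: mulrC.
split; first exact: gor_local.
split; first exact: gor_gorenstein.
exists rigM; split; first exact: rigM_fg.
split; first exact: rigM_indecomposable.
split; first exact: rigM_nonprojective.
by split; [apply: rigM_Ext1 | apply: rigM_Ext2].
Qed.
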